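(* Let $T=(V(T),E(T);f,g)$ be a weighted tree with two or more vertices. Consider the following procedure. Step 1 (initialize): set $p(v_s)=f(v_s)$ for all $v_s\in V(T)$ and $N=0$. Step 2 (contract): (a) choose a pendant vertex $u$ of the current tree and let $e=(u,v)$ denote the pendant edge; (b) replace $p(v)$ with $p(v)(p(u)g(e)+1)$; (c) replace $N$ with $N+p(u)$; (d) eliminate the vertex $u$ and the edge $e$. Step 3: if $v$ is the only remaining vertex, go to Step 4; otherwise, go to Step 2. Step 4: answer $p(v)+N$. Then the answer of the procedure is the generating function of subtrees of $T$, i.e. $F(T;f,g)=p(v)+N$.
   Context: Let $\mathcal R$ be a commutative ring with unit element $1$. A weighted tree $T=(V(T),E(T);f,g)$ is a finite tree with a vertex-weight function $f:V(T)\to\mathcal R$ and an edge-weight function $g:E(T)\to\mathcal R$. A subtree of $T$ is a nonempty connected subgraph of $T$ (single vertices are allowed). The weight $\omega(T_1)$ of a subtree $T_1$ is the product of the weights of all vertices and edges of $T_1$. The generating function of subtrees is $F(T;f,g)=\sum_{T_1}\omega(T_1)$, summed over all subtrees $T_1$ of $T$. A pendant vertex is a vertex of degree $1$; the edge incident to it is its pendant edge. *)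

(* Defs.v *)
From HB Require Import structures.
From mathcomp Require Import all_boot all_algebra.
From Stdlib Require Import Relation_Operators.

Set Implicit Arguments.
Unset Strict Implicit.
Unset Printing Implicit Defensive.

Import GRing.Theory.
Local Open Scope ring_scope.

(* Graphs are pairs (vertex set, edge set) inside an ambient finType, so that  *)
(* subgraphs, and the shrinking trees of the contraction procedure, all live   *)
(* in one finite type; an edge is the two-element set of its ends.             *)
Definition graph (V : finType) : finType := ({set V} * {set {set V}})%type.

Definition vset (V : finType) (G : graph V) : {set V} := G.1.
Definition eset (V : finType) (G : graph V) : {set {set V}} := G.2.

Definition simple_graph (V : finType) (G : graph V) : bool :=
  [forall e in eset G, (e \subset vset G) && (#|e| == 2)%N].

Definition adj (V : finType) (G : graph V) : rel V :=
  fun x y => [set x; y] \in eset G.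

(* Nonemptiness is part of connectedness. *)
Definition connected_graph (V : finType) (G : graph V) : bool :=
  (vset G != set0) &&
  [forall x in vset G, forall y in vset G, connect (adj G) x y].

(* [:: x; y] is a ucycle as soon as xy is an edge; genuine cycles have at      *)
(* least three vertices.                                                       *)
Definition acyclic_graph (V : finType) (G : graph V) : Prop :=
  forall c : seq V, ucycle (adj G) c -> (size c < 3)%N.

Definition is_tree (V : finType) (G : graph V) : Prop :=
  [/\ simple_graph G, connected_graph G & acyclic_graph G].

Definition subgraph (V : finType) (H G : graph V) : bool :=
  [&& simple_graph H, vset H \subset vset G & eset H \subset eset G].

Definition subtree (V : finType) (H T : graph V) : bool :=
  subgraph H T && connected_graph H.

Definition degree (V : finType) (G : graph V) (u : V) : nat :=
  #|[set e in eset G | u \in e]|.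

Definition pendant (V : finType) (G : graph V) (u : V) : bool :=
  (u \in vset G) && (degree G u == 1)%N.

(* The weights f and g are total functions on V and {set V}; only their values *)
(* on the vertices and edges of the graph at hand are ever used.               *)
Definition weight (R : comPzRingType) (V : finType)
    (f : V -> R) (g : {set V} -> R) (H : graph V) : R :=
  (\prod_(x in vset H) f x) * (\prod_(e in eset H) g e).

Definition subtree_gf (R : comPzRingType) (V : finType)
    (T : graph V) (f : V -> R) (g : {set V} -> R) : R :=
  \sum_(H : graph V | subtree H T) weight f g H.

Record state (R : comPzRingType) (V : finType) : Type := State {
  cur : graph V;
  pw : V -> R;
  acc : R
}.

Definition init (R : comPzRingType) (V : finType)
    (T : graph V) (f : V -> R) : state R V := State T f 0.

(* The choice of the pendant vertex u is left open. A simple graph on one      *)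
(* vertex has no pendant vertex, so it admits no further contraction.          *)
Inductive contract (R : comPzRingType) (V : finType) (g : {set V} -> R) :
    state R V -> state R V -> Prop :=
  Contract (G : graph V) (p : V -> R) (N : R) (u v : V) :
    pendant G u -> [set u; v] \in eset G ->
    contract g
      (State G p N)
      (State (vset G :\ u, eset G :\ [set u; v])
             (fun x => if x == v then p v * (p u * g [set u; v] + 1) else p x)
             (N + p u)).

Definition reachable (R : comPzRingType) (V : finType) (g : {set V} -> R) :
    state R V -> state R V -> Prop :=
  clos_refl_trans (state R V) (contract g).

(* Main.v *)
Require Import Defs.
From mathcomp Require Import all_boot all_algebra.

Set Implicit Arguments.
Unset Strict Implicit.
Unset Printing Implicit Defensive.

Import GRing.Theory.
Local Open Scope ring_scope.

(* Deleting a pendant vertex u with neighbour v keeps the graph a tree, and    *)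
(* F(cur) + acc is invariant: a subtree through u is either {u} alone,         *)
(* which accounts for the term p(u), or it arises from a subtree H of the      *)
(* smaller tree containing v by attaching uv, which multiplies the weight of H *)
(* by p(u) g(uv); updating p(v) counts H with and without this attachment.     *)
(* A tree with two or more vertices has a pendant vertex, since otherwise its  *)
(* paths could be extended indefinitely.                                       *)

Section Graphs.

Variable V : finType.
Implicit Types (G H : graph V) (x y u v w : V) (e : {set V}).

(** [subtree_gf (cur s) (pw s) g + acc s] is constant along contractions ([contract_invariant]). It
    starts at F(T; f, g), where [acc] is 0, and once v alone remains it reads [pw s v + acc s] by
    [subtree_gf_set1]. The core is [subtree_gf_prune]: [graft] and [prune] are inverse bijections
    between the subtrees of G - u through v and the subtrees of G that contain u without being u
    alone. Each contraction removes a vertex, so every run ends ([contract_acc]). [tree_prune] keeps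
    the graph a tree and [tree_pendant] supplies the next pendant vertex, so a run can stop only at
    a single vertex. *)

Definition prune u v G : graph V := (vset G :\ u, eset G :\ [set u; v]).
Definition graft u v G : graph V := (u |: vset G, [set u; v] |: eset G).

(** * Edges, neighbours and connectedness in simple graphs *)

Lemma set2_injr x y z : [set x; y] = [set x; z] :> {set V} -> y = z.
Proof.
move=> E.
have: y \in [set x; z] by rewrite -E set22.
have: z \in [set x; y] by rewrite E set22.
by rewrite !inE => /orP[/eqP-> | /eqP->] // /orP[/eqP-> | /eqP->].
Qed.

Lemma adj_sym G : symmetric (adj G).
Proof. by move=> x y; rewrite /adj setUC. Qed.

Lemma connect_adj_sym G : connect_sym (adj G).
Proof. exact/sym_connect_sym/adj_sym. Qed.

Lemma simple_edge_sub G e : simple_graph G -> e \in eset G -> e \subset vset G.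
Proof. by move=> /forall_inP sG /sG /andP[]. Qed.

Lemma simple_edge_vertex G e x :
  simple_graph G -> e \in eset G -> x \in e -> x \in vset G.
Proof. by move=> sG eG; apply/subsetP/simple_edge_sub. Qed.

Lemma simple_adj_neq G x y : simple_graph G -> adj G x y -> x != y.
Proof. by move=> /forall_inP sG /sG /andP[_]; rewrite cards2; case: (x != y). Qed.

Lemma simple_edgeP G e x :
  simple_graph G -> e \in eset G -> x \in e -> exists y, e = [set x; y].
Proof.
move=> /forall_inP sG /sG /andP[_ /cards2P[a [b [_ ->]]]].
by rewrite !inE => /orP[/eqP-> | /eqP->]; [exists b | exists a; rewrite setUC].
Qed.

Lemma connectedP G :
  reflect ((exists x, x \in vset G) /\
           {in vset G &, forall x y, connect (adj G) x y})
          (connected_graph G).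
Proof.
apply: (iffP andP) => [[/set0Pn nz /forall_inP c] | [nz c]]; split=> //.
- by move=> x y xG yG; move/forall_inP: (c x xG); apply.
- exact/set0Pn.
- by apply/forall_inP => x xG; apply/forall_inP => y yG; apply: c.
Qed.

Lemma connected_neighbor G x y :
  connected_graph G -> x \in vset G -> y \in vset G -> x != y ->
  exists z, adj G x z.
Proof.
move=> /connectedP[_ c] xG yG nxy.
case/connectP: (c x y xG yG) => [[|z p]] /= ; first by move=> _ E; rewrite E eqxx in nxy.
by case/andP=> xz _ _; exists z.
Qed.

Lemma pendant_edge G u v e :
  pendant G u -> [set u; v] \in eset G -> e \in eset G -> u \in e ->
  e = [set u; v].
Proof.
case/andP=> _ /cards1P[e0 E] uv eG ue.
have mem a : a \in eset G -> u \in a -> a = e0.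
  by move=> aG ua; apply/set1P; rewrite -E inE aG.
by rewrite (mem e) // (mem [set u; v]) // set21.
Qed.

Lemma pendant_adj G u v w :
  pendant G u -> [set u; v] \in eset G -> adj G u w -> w = v.
Proof. by move=> pu uv uw; apply/set2_injr/(pendant_edge pu uv uw)/set21. Qed.

(** * Deleting and attaching a pendant vertex *)

Lemma simple_prune G H u v :
  pendant G u -> [set u; v] \in eset G -> eset H \subset eset G ->
  simple_graph H -> simple_graph (prune u v H).
Proof.
move=> pu uv HG sH; apply/forall_inP => e; rewrite in_setD1 => /andP[ne eH].
move/forall_inP: (sH) => /(_ e eH) /andP[eV ->]; rewrite andbT subsetD1 eV /=.
apply: contra ne => ue; apply/eqP.
by apply: (pendant_edge pu uv) => //; apply: (subsetP HG).
Qed.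

(* The retraction of H onto H - u moving u to v maps every edge to an edge or  *)
(* to a single vertex, hence preserves connections.                            *)
Lemma connected_prune H u v :
  simple_graph H -> connected_graph H -> [set u; v] \in eset H ->
  (forall w, adj H u w -> w = v) -> connected_graph (prune u v H).
Proof.
move=> sH /connectedP[_ c] uv nb.
have nuv := simple_adj_neq sH uv.
pose r x := if x == u then v else x.
have stepr x y : adj H x y -> connect (adj (prune u v H)) (r x) (r y).
  move=> xy; rewrite /r; case: (x =P u) => [xu | /eqP nxu].
    by rewrite xu in xy; rewrite (nb _ xy); case: ifP.
  case: (y =P u) => [yu | /eqP nyu].
    by rewrite yu adj_sym in xy; rewrite (nb _ xy).
  apply: connect1; rewrite /adj in_setD1 andbC; apply/andP; split=> //.
  apply/eqP => E; have: u \in [set x; y] by rewrite E set21.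
  by rewrite !inE ![u == _]eq_sym (negbTE nxu) (negbTE nyu).
have pathr p x : path (adj H) x p ->
    connect (adj (prune u v H)) (r x) (r (last x p)).
  elim: p x => [|y p IH] x //= /andP[xy yp].
  exact: connect_trans (stepr _ _ xy) (IH _ yp).
apply/connectedP; split.
  exists v; rewrite in_setD1 eq_sym nuv.
  by apply: simple_edge_vertex sH uv _; rewrite set22.
move=> x y; rewrite !in_setD1 => /andP[xu xH] /andP[yu yH].
case/connectP: (c x y xH yH) => p xp Ey.
by move: (pathr p x xp); rewrite -Ey /r (negbTE xu) (negbTE yu).
Qed.

(** Every vertex is joined to v: u by the new edge, the others inside H. *)
Lemma connected_graft H u v :
  connected_graph H -> v \in vset H -> connected_graph (graft u v H).
Proof.
move=> /connectedP[_ c] vH.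
have toV x : x \in vset (graft u v H) -> connect (adj (graft u v H)) x v.
  case/setU1P => [-> | xH]; first by apply: connect1; rewrite /adj setU11.
  apply: (connect_sub _ (c x v xH vH)) => a b ab.
  by apply: connect1; rewrite /adj; apply: setU1r.
apply/connectedP; split; first by exists u; rewrite setU11.
move=> x y /toV xv /toV yv; apply: connect_trans xv _.
by rewrite connect_adj_sym.
Qed.

Lemma tree_prune G u v :
  is_tree G -> pendant G u -> [set u; v] \in eset G -> is_tree (prune u v G).
Proof.
case=> sG cG aG pu uv; split.
- exact: simple_prune pu uv _ sG.
- by apply: connected_prune => // w; apply: pendant_adj pu uv.
(* A cycle of the smaller graph is already a cycle of G. *)
- move=> s /andP[cs us]; apply: aG; rewrite /ucycle us andbT.
  by apply: sub_cycle cs => x y /setD1P[].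
Qed.

(** * Existence of a pendant vertex *)

Lemma other_neighbor G x y :
  simple_graph G -> ~~ pendant G x -> adj G x y ->
  exists2 z, adj G x z & z != y.
Proof.
move=> sG npx xy.
have xG : x \in vset G by apply: simple_edge_vertex sG xy (set21 _ _).
have [/exists_inP[e] | /exists_inPn none] :=
  boolP [exists e in [set e in eset G | x \in e], e != [set x; y]].
  rewrite inE => /andP[eG xe] ne; have [z Ez] := simple_edgeP sG eG xe.
  exists z; first by rewrite /adj -Ez.
  by apply: contra ne => /eqP <-; rewrite Ez.
case/negP: npx; rewrite /pendant xG /=; apply/cards1P; exists [set x; y].
apply/setP => e; rewrite in_set1; apply/idP/eqP => [/none/negbNE/eqP // | ->].
by rewrite inE set21 andbT.
Qed.

(** Without pendant vertices, a path with distinct vertices can always be extended at its head x, so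
    such paths would exist in every length. *)
Lemma tree_pendant G : is_tree G -> (1 < #|vset G|)%N -> exists u, pendant G u.
Proof.
case=> sG cG aG /card_gt1P[a [b [a_in b_in nab]]].
have [/existsP // | /existsPn np] := boolP [exists u, pendant G u].
have long n : exists x p,
    [/\ path (adj G) x p, uniq (x :: p), x \in vset G & size p = n].
  elim: n => [|n [x [p [xp Up xG sp]]]]; first by exists a, [::].
  suff [z xz zp] : exists2 z, adj G x z & z \notin x :: p.
    exists z, (x :: p); split; rewrite /= ?sp // ?zp //.
      by rewrite adj_sym xz.
    by apply: simple_edge_vertex sG xz (set22 _ _).
  (* A one-vertex path is extended by connectedness, since a or b differs from x; a longer one by a
     neighbour of x other than its successor y. *)
  case: p xp Up {sp} => [|y p] xp Up.
    have [y yG nxy] : exists2 y, y \in vset G & x != y.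
      by case: (x =P a) => [-> | /eqP]; [exists b | exists a].
    have [z xz] := connected_neighbor cG xG yG nxy.
    by exists z; rewrite // inE eq_sym (simple_adj_neq sG xz).
  have /andP[xy yp] := xp.
  have [z xz nzy] := other_neighbor sG (np x) xy.
  exists z => //; rewrite !inE negb_or eq_sym (simple_adj_neq sG xz).
  rewrite (negbTE nzy) /=; apply/negP => zp.
  case/splitPr: zp xp Up => p1 p2 xp Up.
  (* If z lay on the path, the segment from x to z would close into a cycle; it has at least three
     vertices because z differs from x and y. *)
  suff /aG : ucycle (adj G) (x :: y :: rcons p1 z) by rewrite /= size_rcons.
  apply/andP; split.
    move: xp; rewrite -cat_rcons /= => /andP[-> +] /=.
    rewrite cat_path [path _ _ (rcons (rcons _ _) _)]rcons_path last_rcons.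
    move=> /andP[-> _] /=.
    by rewrite adj_sym.
  by move: Up; rewrite -cat_rcons -!cat_cons cat_uniq => /andP[].
(* A path with #|V| edges would have #|V| + 1 distinct vertices. *)
have [x [p [_ Up _ sp]]] := long #|V|.
by have := max_card (mem (x :: p)); rewrite (card_uniqP Up) /= sp ltnn.
Qed.

Lemma pendant_neighbor G u :
  simple_graph G -> pendant G u -> exists v, [set u; v] \in eset G.
Proof.
move=> sG /andP[_ /cards1P[e E]].
have: e \in [set e in eset G | u \in e] by rewrite E set11.
rewrite inE => /andP[eG ue]; have [v Ev] := simple_edgeP sG eG ue.
by exists v; rewrite -Ev.
Qed.

(** * Subtrees containing or avoiding a pendant vertex *)

Lemma simple_set1 H x : simple_graph H -> vset H = [set x] -> H = ([set x], set0).
Proof.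
case: H => A B sH /= EA; congr pair => //; apply/setP => e; rewrite inE.
apply/negP => eH; move/forall_inP: sH => /(_ e eH) /andP[/subset_leq_card].
by rewrite /vset /= [A]EA cards1 => le1 /eqP E; rewrite E in le1.
Qed.

Lemma subtree_set1 G x : x \in vset G -> subtree ([set x], set0) G.
Proof.
move=> xG; apply/andP; split.
  rewrite /subgraph /= sub1set xG sub0set !andbT.
  by apply/forall_inP => e; rewrite inE.
apply/connectedP; split; first by exists x; rewrite set11.
by move=> a b /set1P-> /set1P->.
Qed.

Section Pendant.

Variables (G : graph V) (u v : V).
Hypotheses (sG : simple_graph G) (pu : pendant G u) (uvG : [set u; v] \in eset G).

(** A simple graph that avoids u cannot contain the edge uv, so the condition on vertices implies
    the one on edges. *)
Lemma subtree_pruneE H :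
  subtree H (prune u v G) = subtree H G && (u \notin vset H).
Proof.
rewrite /subtree /subgraph /= !subsetD1.
case sH: (simple_graph H) => //=; case uH: (u \in vset H); rewrite /= ?andbF ?andbT //.
suff -> : [set u; v] \notin eset H by rewrite andbT.
by apply/negP => /(simple_edge_vertex sH) /(_ (set21 u v)); rewrite uH.
Qed.

(** Such an H has a second vertex, so by connectedness u has a neighbour in H, which can only be
    v. *)
Lemma subtree_pendant_edge H :
  subtree H G -> u \in vset H -> H != ([set u], set0) -> [set u; v] \in eset H.
Proof.
case/andP=> /and3P[sH VH EH] cH uH nH.
have [y yH nuy] : exists2 y, y \in vset H & u != y.
  apply/exists_inP; apply: contraR nH => /exists_inPn all1.
  apply/eqP/(simple_set1 sH)/setP => y; rewrite inE; apply/idP/eqP => [|-> //].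
  by move/all1/negbNE/eqP.
have [z uz] := connected_neighbor cH uH yH nuy.
by rewrite -(pendant_adj pu uvG (subsetP EH _ uz)).
Qed.

Lemma graftK H : u \notin vset H -> [set u; v] \notin eset H ->
  prune u v (graft u v H) = H.
Proof. by case: H => A B uA uvB; rewrite /prune /= !setU1K. Qed.

Lemma pruneK H : u \in vset H -> [set u; v] \in eset H ->
  graft u v (prune u v H) = H.
Proof. by case: H => A B uA uvB; rewrite /graft /= !setD1K. Qed.

Lemma subtree_prune H :
  subtree H G -> [set u; v] \in eset H -> subtree (prune u v H) (prune u v G).
Proof.
case/andP=> /and3P[sH VH EH] cH uvH; apply/andP; split.
  by rewrite /subgraph (simple_prune pu uvG EH sH) /= !setSD.
apply: connected_prune => // w uw.
by apply: (pendant_adj pu uvG); apply: (subsetP EH).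
Qed.

Lemma subtree_graft H :
  subtree H (prune u v G) -> v \in vset H -> subtree (graft u v H) G.
Proof.
rewrite subtree_pruneE => /andP[/andP[/and3P[sH VH EH] cH] uH] vH.
have uG : u \in vset G by case/andP: pu.
apply/andP; split; last exact: connected_graft.
rewrite /subgraph /= !subUset !sub1set uG uvG VH EH !andbT.
apply/forall_inP => e /setU1P[-> | eH].
  rewrite cards2 (simple_adj_neq sG uvG) eqxx andbT /=.
  by rewrite subUset !sub1set setU11 setU1r.
move/forall_inP: sH => /(_ e eH) /andP[eV ->]; rewrite andbT.
exact: subset_trans eV (subsetUr _ _).
Qed.

End Pendant.

End Graphs.

(** * Weights and the effect of one contraction on the generating function *)

Section Procedure.

Variables (R : comPzRingType) (V : finType) (g : {set V} -> R).
Implicit Types (G H : graph V) (p : V -> R) (u v : V) (s : state R V).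

Lemma weight_set1 p x : weight p g ([set x], set0) = p x.
Proof. by rewrite /weight /= big_set1 big_set0 mulr1. Qed.

Lemma weight_graft p u v H : u \notin vset H -> [set u; v] \notin eset H ->
  weight p g (graft u v H) = p u * g [set u; v] * weight p g H.
Proof. by move=> uH uvH; rewrite /weight /= !big_setU1 //= mulrACA. Qed.

(** The factor [p v] occurs exactly once in the weight if v lies in H, and not at all otherwise. *)
Lemma weight_update p v c H :
  weight (fun x => if x == v then p v * c else p x) g H =
  if v \in vset H then c * weight p g H else weight p g H.
Proof.
rewrite /weight; case: ifPn => vH; last first.
  by congr (_ * _); apply: eq_bigr => x xH; case: eqP => // E; rewrite -E xH in vH.
rewrite mulrA; congr (_ * _); rewrite !(big_setD1 v vH) /= eqxx mulrA [c * _]mulrC.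
by congr (_ * _); apply: eq_bigr => x /setD1P[/negbTE->].
Qed.

Lemma subtree_gf_prune G p u v :
  simple_graph G -> pendant G u -> [set u; v] \in eset G ->
  subtree_gf G p g =
  subtree_gf (prune u v G)
    (fun x => if x == v then p v * (p u * g [set u; v] + 1) else p x) g + p u.
Proof.
move=> sG pu uvG; have uG : u \in vset G by case/andP: pu.
have edgeN H : subtree H (prune u v G) -> [set u; v] \notin eset H.
  by case/andP=> /and3P[_ _ /subsetP EH] _; apply/negP => /EH; rewrite !inE eqxx.
have vertN H : subtree H (prune u v G) -> u \notin vset H.
  by rewrite subtree_pruneE => /andP[].
(* Three classes of subtrees of G: u alone, which gives [p u]; those avoiding u, which are the
   subtrees of G - u; and the others through u, reindexed by [graft]. *)
rewrite /subtree_gf (bigID (fun H => u \in vset H)) /=.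
rewrite (bigD1 (([set u], set0) : graph V)) /=; last first.
  by rewrite subtree_set1 //= set11.
rewrite weight_set1 -addrA addrC; congr (_ + _); rewrite addrC.
rewrite (eq_bigl (fun H => subtree H (prune u v G))); last first.
  by move=> H; rewrite subtree_pruneE.
rewrite [X in _ + X = _](reindex_onto (graft u v) (prune u v)); last first.
  move=> H /andP[/andP[HG uH] nH]; apply: pruneK => //.
  exact: (subtree_pendant_edge pu uvG HG uH nH).
rewrite [X in _ + X = _](eq_bigl
    (fun H => subtree H (prune u v G) && (v \in vset H))); last first.
  move=> H; apply/idP/idP.
    move=> /andP[/andP[/andP[HG uH] nH] /eqP HK].
    have uvH := subtree_pendant_edge pu uvG HG uH nH.
    have := subtree_prune pu uvG HG uvH; rewrite HK => -> /=.
    have [/and3P[sH _ _] _] := andP HG.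
    have := simple_edge_vertex sH uvH (set22 u v).
    by rewrite in_setU1 eq_sym (negbTE (simple_adj_neq sG uvG)).
  move=> /andP[HG vH]; rewrite (subtree_graft sG pu uvG HG vH) /=.
  rewrite setU11 graftK ?edgeN ?vertN // eqxx andbT /=.
  (* A grafted subtree is not u alone, because it has the edge uv. *)
  apply/eqP => /(congr1 (fun K : graph V => [set u; v] \in eset K)).
  by rewrite /= setU11 inE.
(* For H through v, the weights of H and of its graft add up to the updated weight; for H avoiding
   v, the update changes nothing. *)
rewrite [in X in X + _](bigID (fun H => v \in vset H)) /=.
rewrite [RHS](bigID (fun H => v \in vset H)) /= addrAC; congr (_ + _).
  rewrite -big_split; apply: eq_bigr => H /andP[HG vH] /=.
  rewrite weight_update vH weight_graft ?edgeN ?vertN //.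
  by rewrite mulrDl mul1r addrC.
by apply: eq_bigr => H /andP[_ /negbTE vH]; rewrite weight_update vH.
Qed.

Lemma subtree_gf_set1 G p v :
  simple_graph G -> vset G = [set v] -> subtree_gf G p g = p v.
Proof.
move=> sG EG; rewrite /subtree_gf (big_pred1 (([set v], set0) : graph V)) ?weight_set1 //.
move=> H; apply/idP/eqP => [/andP[/and3P[sH VH _] /andP[nz _]] | ->].
  apply: simple_set1 => //; apply/eqP; move: VH; rewrite EG subset1.
  by rewrite (negbTE nz) orbF.
by apply: subtree_set1; rewrite EG set11.
Qed.

(** * Termination, invariance and progress of the procedure *)

(** The number of vertices of the current graph strictly decreases. *)
Lemma contract_acc s : Acc (fun s' s => contract g s s') s.
Proof.
have [n] := ubnP #|vset (cur s)|; elim: n s => [|n IH] s lesn; first by [].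
apply: Acc_intro => s' c; apply: (IH s').
case: c lesn => G p N u v /andP[uG _] _.
by rewrite [#|vset (cur _)|](cardsD1 u) uG.
Qed.

Lemma contract_invariant s s' : contract g s s' -> is_tree (cur s) ->
  is_tree (cur s') /\
  subtree_gf (cur s) (pw s) g + acc s = subtree_gf (cur s') (pw s') g + acc s'.
Proof.
case=> G p N u v pu uv /= tG; split; first exact: tree_prune.
have [sG _ _] := tG.
by rewrite (subtree_gf_prune p sG pu uv) -addrA [p u + N]addrC.
Qed.

Lemma reachable_invariant s s' : reachable g s s' -> is_tree (cur s) ->
  is_tree (cur s') /\
  subtree_gf (cur s) (pw s) g + acc s = subtree_gf (cur s') (pw s') g + acc s'.
Proof.
elim=> [{}s {}s' | {}s | s1 s2 s3 _ IH1 _ IH2] //; first exact: contract_invariant.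
by case/IH1 => /IH2[t3 E2] E1; split; rewrite // E1.
Qed.

Lemma tree_progress s : is_tree (cur s) ->
  (exists v, vset (cur s) = [set v]) \/ (exists s', contract g s s').
Proof.
case: s => G p N /= tG; have [sG /andP[nz _] _] := tG.
have [lt1 | le1] := ltnP 1 #|vset G|.
  have [u pu] := tree_pendant tG lt1; have [v uv] := pendant_neighbor sG pu.
  by right; eexists; apply: Contract pu uv.
left; apply/cards1P; rewrite eqn_leq le1 /=.
by rewrite card_gt0.
Qed.

End Procedure.

Theorem mainTheorem1 (R : comPzRingType) (V : finType) (T : graph V)
    (f : V -> R) (g : {set V} -> R)
    (tree_T : is_tree T) (T_ge2 : (2 <= #|vset T|)%N) :
  (* the procedure terminates, never gets stuck, and answers F(T; f, g) *)
  [/\ Acc (fun s' s : state R V => contract g s s') (init T f),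
      forall s : state R V, reachable g (init T f) s ->
        (exists v : V, vset (cur s) = [set v]) \/
        (exists s' : state R V, contract g s s')
    & forall (s : state R V) (v : V), reachable g (init T f) s ->
        vset (cur s) = [set v] ->
        subtree_gf T f g = pw s v + acc s].
Proof.
split; first exact: contract_acc.
  by move=> s /reachable_invariant[] // ts _; apply: tree_progress.
move=> s v /reachable_invariant[] //= [sG _ _] E Ev.
by rewrite -(subtree_gf_set1 g (pw s) sG Ev) -E addr0.
Qed.
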